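(* Let $n > 0$ and $e \ge 0$ be integers. If a matrix $M \in \mathcal{M}_{n,e}$ satisfies $\rho(M) = \rho(\mathcal{M}_{n,e})$, then $M \in \mathcal{M}_{d_1,n_1,d_2,n_2}$, where $d_1 = \lfloor 2e/n \rfloor$, $d_2 = d_1 + 1$, $n_2 = 2e \bmod n$ and $n_1 = n - n_2$.
   Context: For a square matrix $M$, $\rho(M)$ denotes its spectral radius. $\mathcal{M}_{n,e}$ is the set of symmetric $n\times n$ real matrices with non-negative entries (diagonal entries may be non-zero) such that all row sums are integers and the sum of all entries is $2e$. $\mathcal{M}_{d_1,n_1,d_2,n_2}$ is the set of symmetric $n\times n$ real matrices with non-negative entries, $n = n_1+n_2$, having $n_1$ rows of sum $d_1$ and $n_2$ rows of sum $d_2$. For a set $\mathcal{M}$ of such matrices, $\rho(\mathcal{M}) = \min\{\rho(M) : M \in \mathcal{M}\}$ (the minimum is attained for $\mathcal{M}_{n,e}$ by compactness). *)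

(* Defs.v *)
From HB Require Import structures.
From mathcomp Require Import all_boot all_order all_algebra.
From mathcomp Require Import boolp classical_sets reals.
From mathcomp Require Import complex.

Set Implicit Arguments.
Unset Strict Implicit.
Unset Printing Implicit Defensive.

Import Order.TTheory GRing.Theory Num.Theory.
Local Open Scope ring_scope.
Local Open Scope classical_set_scope.

Definition spectrum (R : realType) (n : nat) (M : 'M[R]_n) : set R[i] :=
  [set z | eigenvalue (map_mx (real_complex R) M) z].

(* For n > 0 the spectrum is finite and nonempty, so this supremum is the
   maximum modulus of the complex eigenvalues. *)
Definition spectral_radius (R : realType) (n : nat) (M : 'M[R]_n) : R :=
  sup [set ComplexField.Normc.normc z | z in spectrum M].

(* The infimum of nonnegative reals; it is the minimum whenever the minimum
   is attained. *)
Definition min_spectral_radius (R : realType) (n : nat) (S : set 'M[R]_n) : R :=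
  inf [set spectral_radius M | M in S].

Definition row_sum (R : realType) (n : nat) (M : 'M[R]_n) (i : 'I_n) : R :=
  \sum_j M i j.

Definition nonneg_symmetric (R : realType) (n : nat) (M : 'M[R]_n) : Prop :=
  M^T = M /\ (forall i j, 0 <= M i j).

Definition Mat_edges (R : realType) (n e : nat) : set 'M[R]_n :=
  [set M | [/\ nonneg_symmetric M,
               forall i, row_sum M i \is a Num.int
             & \sum_i \sum_j M i j = (2 * e)%:R]].

(* The order n of the matrices is a parameter constrained by n = n1 + n2, so
   that no cast between 'M_n and 'M_(n1 + n2) is needed.  Rows are assigned to
   the two groups through a set A of row indices, which also covers d1 = d2. *)
Definition Mat_rows (R : realType) (n d1 n1 d2 n2 : nat) : set 'M[R]_n :=
  [set M | [/\ n = (n1 + n2)%N, nonneg_symmetric M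
             & exists A : {set 'I_n},
                 [/\ #|A| = n1, #|~: A| = n2,
                     forall i, i \in A -> row_sum M i = d1%:R
                   & forall i, i \notin A -> row_sum M i = d2%:R]]].

Arguments Mat_edges : clear implicits.
Arguments Mat_rows : clear implicits.

(* Main.v *)
Require Import Defs.
From mathcomp Require Import all_boot all_order all_algebra.
From mathcomp Require Import boolp classical_sets reals.
From mathcomp Require Import complex.
From mathcomp Require Import ring lra zify.

(** Put [S = 2e].  The degrees that the theorem predicts are [p] on [m]
    rows and [q = p +- 1] on the other [m'] rows, where [{p, q} = {d1, d2}] and
    [p] is chosen so that [m * p <= m' * q].  Under this condition there is a
    matrix with these row sums which vanishes on the block of the [m] rows of
    sum [p] and is constant on each of the remaining blocks
    ([two_level_mx]).  Its spectral radius is at most the positive root [l] of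
      [m' l^2 = (m' q - m p) l + m p^2],
    by a weighted AM-GM estimate of its quadratic form (a Schur test), so a
    minimiser [M] satisfies [rho(M) <= l].

    The converse estimate is a Rayleigh quotient.  The two-level matrix has
    the eigenvector equal to [p] on its first block and [l] on the second, so
    for an arbitrary [M] with integer row sums [s_i] one tests [M] against the
    vector [x] equal to [p] on the set [P] of the rows whose sum is on the
    [p] side (at most [p] if [p < q], at least [p] if [p > q]) and to [l]
    elsewhere.  Expanded around the constant vector [l], the form [x^T M x]
    depends only on [P] and the row sums, up to the sum of [M] over [P x P],
    which enters with coefficient [(l - p)^2] and is nonnegative.  With [k = |l - p|] and with
    [d] the sum over [P] of the distances [|s_i - p|], the inequality
    [x^T M x <= l x^T x] becomes
      [k^2 |P| + 2 k d <= l (l n - S) = k^2 m].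
    Off [P] the row sums, being integers, are at distance at least 1 from [p];
    counting [S] gives [|P| >= m - d].  Together, [k (2 - k) d <= 0].  Since
    [0 < k < 2], this forces [d = 0] and [|P| = m], and the count of [S] is then an
    equality: the row sums are exactly [p] on [P] and [q] off [P].

    Two facts link this to the spectral radius: a symmetric matrix satisfies
    [x^T M x <= rho(M) x^T x] ([quad_form_le_spectral_radius], by the spectral
    theorem), and for an entrywise nonnegative matrix an upper bound on the
    real quadratic form bounds every complex eigenvalue
    ([eigenvalue_le_quad_form]).  The division by [l] requires [l > 0], so
    [e = 0], where [M = 0], is treated apart. *)

Set Implicit Arguments.
Unset Strict Implicit.
Unset Printing Implicit Defensive.

Import Order.TTheory GRing.Theory Num.Theory.
Local Open Scope ring_scope.
Local Open Scope classical_set_scope.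

(** * Quadratic forms *)

Definition quad_form (R : pzRingType) (n : nat) (M : 'M[R]_n) (x : 'I_n -> R) : R :=
  \sum_i \sum_j x i * M i j * x j.

(** Each cross term [2 u_i M_ij u_j] is at most
    [w_ij u_i^2 + w_ji u_j^2], because [|M_ij|] is the geometric mean of
    [w_ij] and [w_ji]; the form is thus bounded by the row sums of [w], which
    can be smaller than those of [M] where it matters. *)
Lemma quad_form_schur_test (R : realType) n (M w : 'M[R]_n) (c : R) u :
  (forall i j, 0 <= w i j) -> (forall i j, M i j ^+ 2 = w i j * w j i) ->
  (forall i, row_sum w i <= c) ->
  quad_form M u <= c * \sum_i u i ^+ 2.
Proof.
move=> w0 wM wc.
have amgm i j : u i * M i j * u j <= 2^-1 * (u i ^+ 2 * w i j + u j ^+ 2 * w j i).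
  set x := u i ^+ 2 * _; set y := u j ^+ 2 * _.
  have x0 : 0 <= x by rewrite mulr_ge0 ?sqr_ge0.
  have y0 : 0 <= y by rewrite mulr_ge0 ?sqr_ge0.
  rewrite (le_trans (ler_norm _)) // -(ler_pXn2r (ltn0Sn 1)) ?nnegrE //; last first.
    by rewrite mulr_ge0 ?addr_ge0 ?invr_ge0 ?ler0n.
  have -> : `|u i * M i j * u j| ^+ 2 = x * y.
    by rewrite real_normK ?num_real // !exprMn wM /x /y; ring.
  by have := sqr_ge0 (x - y); lra.
apply: (@le_trans _ _ (\sum_i \sum_j u i ^+ 2 * w i j)); last first.
  rewrite mulr_sumr; apply: ler_sum => i _.
  by rewrite -mulr_sumr mulrC ler_wpM2r ?sqr_ge0 ?wc.
set S := leRHS; have -> : S = 2^-1 * (S + S) by field.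
rewrite {2}/S exchange_big /= -big_split mulr_sumr.
apply: ler_sum => i _ /=; rewrite -big_split mulr_sumr.
by apply: ler_sum => j _; exact: amgm.
Qed.

Lemma quad_form_affine (R : realType) n (M : 'M[R]_n) (a c : R) (b : 'I_n -> R) : M^T = M ->
  quad_form M (fun i => a - c * b i) =
  a ^+ 2 * \sum_i row_sum M i - (2 * a * c) * \sum_i b i * row_sum M i
  + c ^+ 2 * quad_form M b.
Proof.
move=> Msym; rewrite /quad_form /row_sum !mulr_sumr.
have sw : \sum_i \sum_j M i j * b j = \sum_i b i * \sum_j M i j.
  rewrite exchange_big; apply: eq_bigr => j _ /=; rewrite mulr_sumr.
  by apply: eq_bigr => i _; rewrite -[in LHS]Msym mxE mulrC.
have -> : \sum_i 2 * a * c * (b i * \sum_j M i j) =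
  a * c * (\sum_i b i * \sum_j M i j) + a * c * \sum_i \sum_j M i j * b j.
  by rewrite sw -mulr_sumr; ring.
rewrite !mulr_sumr opprD addrA -!sumrN -!big_split /=; apply: eq_bigr => i _.
rewrite !mulr_sumr -!sumrN -!big_split /=; apply: eq_bigr => j _; ring.
Qed.

(** * The spectral radius of a nonnegative symmetric matrix *)

Section SpectralRadius.
Variables (R : realType) (n : nat).
Implicit Types M : 'M[R]_n.
Local Notation normc := ComplexField.Normc.normc.

Lemma normc_ge0 (z : R[i]) : 0 <= normc z.
Proof. by case: z => a b; rewrite sqrtr_ge0. Qed.

Lemma normc_normr (z : R[i]) : (normc z)%:C%C = `|z|.
Proof. by []. Qed.

Lemma real_complex_real (x : R) : x%:C%C \is Num.real.
Proof. by rewrite realE -[0]/(0%:C%C) !lecR -realE num_real. Qed.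

(** If [v] is an eigenvector for [z], then [u = |v|] satisfies
    [|z| u <= u M] entrywise; pairing with [u] bounds [|z|] by the Rayleigh
    quotient of [u]. *)
Lemma eigenvalue_le_quad_form M (c : R) z :
  (forall i j, 0 <= M i j) ->
  (forall u, quad_form M u <= c * \sum_i u i ^+ 2) ->
  spectrum M z -> normc z <= c.
Proof.
move=> M0 Mc /eigenvalueP[v vM v0].
pose u j := normc (v 0 j).
have zu j : normc z * u j <= \sum_i u i * M i j.
  rewrite -lecR rmorphM rmorph_sum /= !normc_normr -normrM.
  have -> : z * v 0 j = (v *m map_mx (real_complex R) M) 0 j by rewrite vM mxE.
  rewrite mxE (le_trans (ler_norm_sum _ _ _))//.
  apply: ler_sum => i _; rewrite normrM mxE rmorphM /= normc_normr.
  by rewrite [X in _ * X]ger0_norm // lecR.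
have u2 : 0 < \sum_i u i ^+ 2.
  rewrite lt_neqAle sumr_ge0 ?andbT; last by move=> i _; rewrite sqr_ge0.
  apply: contra_neq v0 => /esym/eqP; rewrite psumr_eq0; last by move=> i _; rewrite sqr_ge0.
  move=> /allP u0; apply/rowP => i; rewrite mxE.
  apply: ComplexField.Normc.eq0_normc; apply/eqP; rewrite -[_ == _]sqrf_eq0.
  exact/u0/mem_index_enum.
rewrite -(ler_pM2r u2) (le_trans _ (Mc u)) // mulr_sumr /quad_form exchange_big /=.
apply: ler_sum => j _; rewrite expr2 mulrA -mulr_suml.
by rewrite ler_wpM2r // normc_ge0.
Qed.

Lemma spectrum_neq0 M : (0 < n)%N -> spectrum M !=set0.
Proof. by move=> n0; have [z] := eigenvalue_closed (map_mx (real_complex R) M) n0; exists z. Qed.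

Lemma spectral_radius_ub M (c : R) : (0 < n)%N ->
  (forall z, spectrum M z -> normc z <= c) -> spectral_radius M <= c.
Proof.
move=> /(spectrum_neq0 M)[z0 Mz0] le_c; apply: ge_sup; first by exists (normc z0), z0.
by move=> _ [z Mz <-]; apply: le_c.
Qed.

(** The supremum defining the spectral radius is only meaningful once the
    spectrum is bounded; the sum of all entries is a crude bound. *)
Lemma normc_le_spectral_radius M z :
  nonneg_symmetric M -> spectrum M z -> normc z <= spectral_radius M.
Proof.
move=> [Msym M0] Mz; apply: ub_le_sup; last by exists z.
exists (\sum_i row_sum M i) => _ [w Mw <-].
apply: (eigenvalue_le_quad_form M0 _ Mw) => u.
apply: (@quad_form_schur_test _ _ _ M) => // [i j|i].
  by rewrite -[in M j i]Msym mxE expr2.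
rewrite (bigD1 i) //= lerDl sumr_ge0 // => k _.
by rewrite sumr_ge0.
Qed.

Lemma spectral_radius_ge0 M : (0 < n)%N -> nonneg_symmetric M ->
  0 <= spectral_radius M.
Proof.
move=> /(spectrum_neq0 M)[z Mz] Mns.
exact: le_trans (normc_ge0 z) (normc_le_spectral_radius Mns Mz).
Qed.

(** By the spectral theorem the form is diagonal in unitary coordinates, with
    the eigenvalues as coefficients. *)
Lemma quad_form_le_spectral_radius M x :
  nonneg_symmetric M ->
  quad_form M x <= spectral_radius M * \sum_i x i ^+ 2.
Proof.
move=> Mns; have [Msym M0] := Mns.
pose A := map_mx (real_complex R) M.
pose P := spectralmx A; pose D := spectral_diag A.
have Punit : P \in unitmx := spectral_unit A.
have AE : A = invmx P *m diag_mx D *m P.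
  apply/orthomx_spectralP/hermitian_normalmx/realsym_hermsym.
  - apply/is_hermitianmxP; rewrite expr0 scale1r.
    by apply/matrixP => i j; rewrite !mxE -[in RHS]Msym mxE.
  - by apply/mxOverP => i j; rewrite mxE real_complex_real.
(* The rows of P are left eigenvectors, so the diagonal of D is in the spectrum. *)
have De k : spectrum M (D 0 k).
  apply/eigenvalueP; exists (row k P).
    rewrite -/A -row_mul [in LHS]AE !mulmxA mulmxV // mul1mx.
    by apply/rowP => j; rewrite mxE mul_diag_mx !mxE.
  have := Punit; rewrite -row_free_unit => Pf.
  apply: contraTneq isT => /(congr1 (mulmx^~ (invmx P))).
  rewrite mul0mx -row_mul mulmxV // => /rowP/(_ k); rewrite !mxE eqxx => /eqP.
  by rewrite oner_eq0.
(* In the coordinates w of x along the rows of P, both the form and the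
   squared norm of x are diagonal. *)
pose v : 'rV_n := \row_i (x i)%:C%C.
pose w := v *m map_mx Num.conj P^T.
have PE : invmx P = map_mx Num.conj P^T by rewrite invmx_unitary ?spectral_unitarymx.
have wE : map_mx Num.conj w^T = P *m v^T.
  rewrite /w trmx_mul map_mxM trmxCK; congr (_ *m _).
  by apply/matrixP => i j; rewrite !mxE; apply/CrealP/real_complex_real.
have qE : (quad_form M x)%:C%C = \sum_k D 0 k * `|w 0 k| ^+ 2.
  transitivity ((v *m A *m v^T) 0 0).
    rewrite /quad_form exchange_big mxE rmorph_sum; apply: eq_bigr => j _ /=.
    rewrite !mxE mulr_suml rmorph_sum; apply: eq_bigr => i _ /=.
    by rewrite !rmorphM !mxE.
  rewrite AE PE !mulmxA -/w -mulmxA -wE mxE; apply: eq_bigr => k _.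
  by rewrite mul_mx_diag !mxE normCK; ring.
have nE : (\sum_i x i ^+ 2)%:C%C = \sum_k `|w 0 k| ^+ 2.
  transitivity ((v *m v^T) 0 0).
    by rewrite mxE rmorph_sum; apply: eq_bigr => j _; rewrite !mxE -expr2 rmorphXn.
  rewrite -[v in v *m _](mulmxKV Punit) PE -/w -mulmxA -wE mxE; apply: eq_bigr => k _.
  by rewrite !mxE normCK.
rewrite -lecR rmorphM /= nE (le_trans (real_ler_norm (real_complex_real _))) //.
rewrite qE mulr_sumr (le_trans (ler_norm_sum _ _ _))//.
apply: ler_sum => k _; rewrite normrM [X in _ * X]ger0_norm ?exprn_ge0 //.
rewrite ler_wpM2r ?exprn_ge0 //= -normc_normr lecR.
exact: normc_le_spectral_radius.
Qed.

End SpectralRadius.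

(** * Row sums of matrices of small spectral radius *)

(** The extremal argument: the root [l] is exactly the value for which the
    predicted degrees give equality, and any deviation [d] costs [2 k d] in the
    Rayleigh quotient while it gains only [k^2 d] from a smaller [P]. *)
Lemma row_sums_of_small_spectral_radius (R : realType) n (M : 'M[R]_n) (p q l : R) (m m' : nat) :
  nonneg_symmetric M -> (forall i, row_sum M i - p \is a Num.int) ->
  \sum_i row_sum M i = m%:R * p + m'%:R * q -> n = (m + m')%N ->
  (q - p) ^+ 2 = 1 -> 0 < l -> 0 < (q - p) * (l - p) < 2 ->
  m'%:R * l ^+ 2 = (m'%:R * q - m%:R * p) * l + m%:R * p ^+ 2 ->
  spectral_radius M <= l ->
  exists P : {set 'I_n}, [/\ #|P| = m, forall i, i \in P -> row_sum M i = p
    & forall i, i \notin P -> row_sum M i = q].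
Proof.
move=> Mns Mint Msum nE sg1 l0 /andP[k0 k2] lE rho.
(* sg is the sign of q - p and k = |l - p|. *)
set sg := q - p in sg1 k0 k2; set k := sg * _ in k0 k2.
(* t is the signed distance to p, towards q; P is the side away from q. *)
pose t i := sg * (row_sum M i - p).
pose P := [set i | t i <= 0]%SET.
pose b i : R := if i \in P then 1 else 0.
have b0 i : 0 <= b i by rewrite /b; case: ifP; rewrite ?ler01.
have bb i : b i ^+ 2 = b i by rewrite /b; case: (_ \in _); rewrite ?expr1n ?expr0n.
have sgint : sg \is a Num.int.
  by move/eqP: sg1; rewrite sqrf_eq1 => /orP[]/eqP->; rewrite ?rpredN rpred1.
have sE i : row_sum M i = p + sg * t i.
  by rewrite /t mulrA -expr2 sg1 mul1r addrC subrK.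
have t1 i : i \notin P -> 1 <= t i.
  rewrite inE -ltNge; have : t i \is a Num.int by rewrite rpredM.
  by move=> /intrP[z ->]; rewrite ltr0z ler1z.
have piE : \sum_i b i = #|P|%:R.
  by rewrite -sum1_card natr_sum [RHS]big_mkcond.
pose d := - \sum_i b i * t i.
have nb i : 0 <= - (b i * t i).
  rewrite /b inE; case: (lerP (t i) 0) => h; first by rewrite mul1r oppr_ge0.
  by rewrite mul0r oppr0.
have nb' i : 0 <= (1 - b i) * (t i - 1).
  have := t1 i; rewrite /b; case: (i \in P) => /= h; first by rewrite subrr mul0r.
  by rewrite subr0 mul1r subr_ge0 h.
have d0 : 0 <= d by rewrite /d -sumrN sumr_ge0.
have nR : n%:R = m%:R + m'%:R :> R by rewrite nE natrD.
have n1 : n%:R = \sum_(i < n) 1 :> R by rewrite sumr_const card_ord.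
have tsum : \sum_i t i = m'%:R.
  rewrite -mulr_sumr sumrB Msum sumr_const card_ord -[p *+ n]mulr_natl nR.
  by rewrite -[RHS]mulr1 -sg1 /sg; ring.
(* Integrality makes each term below nonnegative, so the sum compares #|P| with m. *)
have offE : \sum_i (1 - b i) * (t i - 1) = #|P|%:R - m%:R + d.
  rewrite -piE /d; have -> : m%:R = n%:R - \sum_i t i by rewrite tsum nR; ring.
  rewrite n1 -!sumrN -!big_split /= -sumrN -!big_split /=.
  by apply: eq_bigr => i _; ring.
have off0 : 0 <= #|P|%:R - m%:R + d by rewrite -offE sumr_ge0.
have bs : \sum_i b i * row_sum M i = p * #|P|%:R - sg * d.
  rewrite /d mulrN opprK -piE !mulr_sumr -big_split /=.
  by apply: eq_bigr => i _; rewrite sE; ring.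
have xx : \sum_i (l - sg * k * b i) ^+ 2 =
    l ^+ 2 * n%:R - 2 * l * (sg * k) * #|P|%:R + k ^+ 2 * #|P|%:R.
  rewrite -piE n1 !mulr_sumr -sumrN -!big_split /=.
  apply: eq_bigr => i _; rewrite sqrrB !exprMn sg1 bb; ring.
have Qb : 0 <= quad_form M b.
  apply: sumr_ge0 => i _; apply: sumr_ge0 => j _.
  by rewrite !mulr_ge0 //; case: Mns.
(* The Rayleigh bound at the vector p on P and l off P, divided by l. *)
have key : k ^+ 2 * #|P|%:R + 2 * k * d <= k ^+ 2 * m%:R.
  have xx0 : 0 <= \sum_i (l - sg * k * b i) ^+ 2.
    by apply: sumr_ge0 => i _; rewrite sqr_ge0.
  have := le_trans (quad_form_le_spectral_radius (fun i => l - sg * k * b i) Mns)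
     (ler_wpM2r xx0 rho).
  rewrite xx quad_form_affine ?(proj1 Mns) // bs Msum exprMn sg1 mul1r.
  have kQ : 0 <= k ^+ 2 * quad_form M b by rewrite mulr_ge0 ?sqr_ge0.
  move=> H; rewrite -subr_ge0 -(pmulr_rge0 _ l0).
  have lp : sg * k = l - p by rewrite /k mulrA -expr2 sg1 mul1r.
  have k2E : k ^+ 2 = (l - p) ^+ 2 by rewrite /k exprMn sg1 mul1r.
  have sskd : 2 * l * (sg * k) * (sg * d) = 2 * l * k * d.
    by rewrite -[k in RHS]mul1r -sg1; ring.
  have km : k ^+ 2 * m%:R = l * (l * n%:R - (m%:R * p + m'%:R * q)).
    by rewrite k2E nR; move: lE; lra.
  rewrite km.
  move: H; rewrite mulrBr sskd lp k2E; nra.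
(* Both inequalities combine to k * (2 - k) * d <= 0. *)
have kk : 0 < k * (2 - k) by rewrite mulr_gt0 ?subr_gt0.
have dz : d = 0 by nra.
have cP : #|P|%:R = m%:R :> R.
  apply/eqP; rewrite eq_le; apply/andP; split; last by move: off0; rewrite dz; lra.
  by rewrite -(ler_pM2l (exprn_gt0 2 k0)); move: key; rewrite dz; lra.
exists P; split.
- by apply/eqP; rewrite -(eqr_nat R) cP.
- move=> i iP; have /eqP : \sum_i - (b i * t i) = 0 by rewrite sumrN -/d.
  rewrite psumr_eq0 // => /allP/(_ i (mem_index_enum _)).
  by rewrite /b iP mul1r oppr_eq0 sE => /eqP->; rewrite mulr0 addr0.
- move=> i iP; have /eqP : \sum_i (1 - b i) * (t i - 1) = 0 by rewrite offE cP dz; ring.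
  rewrite psumr_eq0 // => /allP/(_ i (mem_index_enum _)).
  by rewrite /b (negPf iP) subr0 mul1r subr_eq0 sE => /eqP->; rewrite /sg; ring.
Qed.

(** * An extremal matrix *)

Lemma sum_two_level (R : realType) n m m' (a b : R) : n = (m + m')%N ->
  \sum_(j < n) (if (j < m)%N then a else b) = m%:R * a + m'%:R * b.
Proof.
move=> ->; rewrite big_split_ord /=; congr (_ + _).
  under eq_bigr => i _ do rewrite ltn_ord.
  by rewrite sumr_const card_ord mulr_natl.
under eq_bigr => i _ do rewrite ltnNge leq_addr.
by rewrite sumr_const card_ord mulr_natl.
Qed.

(** For given row sums the spectral radius decreases as mass moves between the
    two groups of rows.  The zero block says that the first [m] rows have all
    of theirs there; [m * p <= m' * q] leaves the last block nonnegative. *)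
Definition two_level_mx (R : realType) n (m m' : nat) (p q : R) : 'M[R]_n :=
  \matrix_(i, j) if (i < m)%N then (if (j < m)%N then 0 else p / m'%:R)
    else (if (j < m)%N then p / m'%:R else (q - m%:R * p / m'%:R) / m'%:R).

Section TwoLevel.
Variables (R : realType) (n m m' : nat) (p q : R).
Hypotheses (nE : n = (m + m')%N) (m'0 : (0 < m')%N) (p0 : 0 <= p)
  (pq : m%:R * p <= m'%:R * q).
Let M := two_level_mx n m m' p q.

Let m'R : 0 < m'%:R :> R.
Proof. by rewrite ltr0n. Qed.

Let r0 : 0 <= q - m%:R * p / m'%:R.
Proof. by rewrite subr_ge0 ler_pdivrMr // [q * _]mulrC. Qed.

Lemma two_level_nonneg_symmetric : nonneg_symmetric M.
Proof.
split; first by apply/matrixP => i j; rewrite !mxE; do 2!case: ifP.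
by move=> i j; rewrite mxE; do 2!case: ifP => _ //; rewrite divr_ge0 // ltW.
Qed.

Lemma row_sum_two_level i : row_sum M i = if (i < m)%N then p else q.
Proof.
rewrite /row_sum; under eq_bigr => j _ do rewrite mxE.
case: ifP => _; rewrite (sum_two_level _ _ nE); field; exact: lt0r_neq0.
Qed.

Lemma sum_two_level_mx : \sum_i \sum_j M i j = m%:R * p + m'%:R * q.
Proof.
by rewrite -(sum_two_level _ _ nE); apply: eq_bigr => i _; exact: row_sum_two_level.
Qed.

(** The equation for [l] is the characteristic equation of the quotient of the
    matrix by its two groups, with eigenvector [(p, l)].  The Schur weights are
    [M_ij x_j / x_i] for this eigenvector [x], with the factor [p] cancelled
    in advance because [p] may be 0. *)
Lemma quad_form_two_level (l : R) u : 0 < l ->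
  m'%:R * l ^+ 2 = (m'%:R * q - m%:R * p) * l + m%:R * p ^+ 2 ->
  quad_form M u <= l * \sum_i u i ^+ 2.
Proof.
move=> l0 lE.
pose w : 'M[R]_n := \matrix_(i, j) if (i < m)%N
  then (if (j < m)%N then 0 else l / m'%:R)
  else (if (j < m)%N then p ^+ 2 / (m'%:R * l) else (q - m%:R * p / m'%:R) / m'%:R).
have [m'n ln] := (lt0r_neq0 m'R, lt0r_neq0 l0).
apply: (@quad_form_schur_test _ _ _ w).
- move=> i j; rewrite mxE; do 2!case: ifP => _ //; rewrite divr_ge0 ?exprn_ge0 ?mulr_ge0 ?(ltW l0) ?(ltW m'R) //.
- move=> i j; rewrite !mxE; do 2!case: ifP => _; first [by rewrite mulr0 expr0n | by field; rewrite ?ln ?m'n].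
move=> i; rewrite /row_sum; under eq_bigr => j _ do rewrite mxE.
case: (i < m)%N; rewrite (sum_two_level _ _ nE) le_eqVlt; apply/orP; left; apply/eqP.
  by field; rewrite ?m'n.
apply: (mulIf (mulf_neq0 m'n ln)).
have -> : l * (m'%:R * l) = m'%:R * l ^+ 2 by ring.
rewrite lE; field; by rewrite ?ln ?m'n.
Qed.
End TwoLevel.

(** With [F t = m' t^2 - (m' q - m p) t - m p^2], one has
    [F p = m' p (p - q)] and [F q = m p (q - p)], of weakly opposite signs: the
    positive root lies between [p] and [q], hence within distance 1 of [p]. *)
Lemma two_level_radius_exists (R : realType) (m m' p q : R) :
  0 <= m -> 0 < m' -> 0 <= p -> 0 <= q -> m * p <= m' * q -> 0 < m * p + m' * q ->
  (q - p) ^+ 2 = 1 ->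
  exists l, [/\ 0 < l, 0 < (q - p) * (l - p) < 2
    & m' * l ^+ 2 = (m' * q - m * p) * l + m * p ^+ 2].
Proof.
move=> m0 m'0 p0 q0 pq S0 sg1.
pose r := m' * q - m * p; pose s := Num.sqrt (r ^+ 2 + 4 * m' * (m * p ^+ 2)).
have r0 : 0 <= r by rewrite subr_ge0.
have s0 : 0 <= s by apply: sqrtr_ge0.
have mp0 : 0 <= m * p by rewrite mulr_ge0.
have mp20 : 0 <= m * p ^+ 2 by rewrite mulr_ge0 ?sqr_ge0.
have s2 : s ^+ 2 = r ^+ 2 + 4 * m' * (m * p ^+ 2).
  by rewrite sqr_sqrtr // addr_ge0 ?sqr_ge0 // !mulr_ge0 // ltW.
pose l := (r + s) / (2 * m').
have lE : m' * l ^+ 2 = r * l + m * p ^+ 2.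
  have -> : m * p ^+ 2 = (s ^+ 2 - r ^+ 2) / (4 * m').
    by rewrite s2; field; exact: lt0r_neq0.
  by rewrite /l; field; exact: lt0r_neq0.
have rl : r <= m' * l.
  have -> : m' * l = (r + s) / 2 by rewrite /l; field; exact: lt0r_neq0.
  have : r <= s by rewrite -(ler_pXn2r (ltn0Sn 1)) ?nnegrE // s2 lerDl !mulr_ge0 // ltW.
  lra.
have l0 : 0 < l.
  rewrite divr_gt0 ?mulr_gt0 // lt_neqAle addr_ge0 // andbT eq_sym paddr_eq0 //.
  apply/negP => /andP[/eqP rz /eqP sz].
  have : m' * (m * p ^+ 2) = 0 by move: s2; rewrite rz sz; lra.
  move/eqP; rewrite mulf_eq0 (gt_eqF m'0) orFb mulf_eq0 sqrf_eq0 -mulf_eq0 => /eqP mpz.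
  by move: S0 rz; rewrite /r mpz; lra.
clearbody l; exists l; split => //.
have fac t : (t - l) * (m' * t + (m' * l - r)) = m' * t ^+ 2 - r * t - m * p ^+ 2.
  have -> : m * p ^+ 2 = m' * l ^+ 2 - r * l by rewrite lE; ring.
  by ring.
have Fp := fac p; have Fq := fac q.
have Ep : m' * p ^+ 2 - r * p - m * p ^+ 2 = m' * p * (p - q) by rewrite /r; ring.
have Eq : m' * q ^+ 2 - r * q - m * p ^+ 2 = m * p * (q - p) by rewrite /r; ring.
rewrite {}Ep in Fp; rewrite {}Eq in Fq.
have Gp : 0 <= m' * p + (m' * l - r) by rewrite addr_ge0 ?subr_ge0 ?mulr_ge0 // ltW.
move/eqP: sg1; rewrite sqrf_eq1 => /orP[]/eqP sg.
- have pl : p < l.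
    have [->//|pn] := eqVneq p 0; rewrite ltNge; apply/negP => lp.
    have pp : 0 < m' * p by rewrite mulr_gt0 // lt_neqAle eq_sym pn.
    have : 0 <= (p - l) * (m' * p + (m' * l - r)) by rewrite mulr_ge0 ?subr_ge0.
    have pq1 : p - q = -1 by lra.
    by rewrite Fp pq1; lra.
  have lq : l <= q.
    rewrite leNgt; apply/negP => ql.
    have : (q - l) * (m' * q + (m' * l - r)) < 0.
      rewrite nmulr_rlt0 ?subr_lt0 // ltr_wpDr ?subr_ge0 // mulr_gt0 //; lra.
    by rewrite Fq sg mulr1; lra.
  by rewrite sg mul1r; apply/andP; split; lra.
- have lp : l < p.
    rewrite ltNge; apply/negP => pl.
    have : (p - l) * (m' * p + (m' * l - r)) <= 0 by rewrite mulr_le0_ge0 ?subr_le0.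
    have pq1 : p - q = 1 by lra.
    have : 0 < m' * p by rewrite mulr_gt0 //; lra.
    by rewrite Fp pq1; lra.
  have ql : q <= l.
    rewrite leNgt; apply/negP => lq.
    have : 0 < (q - l) * (m' * q + (m' * l - r)).
      by rewrite mulr_gt0 ?subr_gt0 // ltr_wpDr ?subr_ge0 // mulr_gt0 //; lra.
    by rewrite Fq sg; lra.
  by rewrite sg; apply/andP; split; lra.
Qed.

(** * Minimisers of the spectral radius *)

Lemma min_spectral_radius_le (R : realType) n e (N : 'M[R]_n) : (0 < n)%N ->
  Mat_edges R n e N -> min_spectral_radius (Mat_edges R n e) <= spectral_radius N.
Proof.
move=> n0 Ne; apply: ge_inf; last by exists N.
by exists 0 => _ [N' [N'ns _ _] <-]; exact: spectral_radius_ge0.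
Qed.

Lemma row_sums_of_minimizer (R : realType) n e (M : 'M[R]_n) (m m' p q : nat) :
  Mat_edges R n e M ->
  spectral_radius M = min_spectral_radius (Mat_edges R n e) ->
  (0 < e)%N -> n = (m + m')%N -> (0 < m')%N ->
  (2 * e = m * p + m' * q)%N -> (m * p <= m' * q)%N ->
  q = p.+1 \/ p = q.+1 ->
  exists P : {set 'I_n}, [/\ #|P| = m, forall i, i \in P -> row_sum M i = p%:R
    & forall i, i \notin P -> row_sum M i = q%:R].
Proof.
move=> [Mns Mint Msum] Mmin e0 nE m'0 eE pq pq1.
have n0 : (0 < n)%N by lia.
have pqR : m%:R * p%:R <= m'%:R * q%:R :> R by rewrite -!natrM ler_nat.
have SE : (2 * e)%:R = m%:R * p%:R + m'%:R * q%:R :> R by rewrite eE natrD !natrM.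
have sg1 : (q%:R - p%:R) ^+ 2 = 1 :> R by case: pq1 => ->; ring.
have [|||||||l [l0 lp lE]] := @two_level_radius_exists R m%:R m'%:R p%:R q%:R => //.
- by rewrite ltr0n.
- by rewrite -SE ltr0n; lia.
pose N := two_level_mx n m m' (p%:R : R) q%:R.
have Nns : nonneg_symmetric N by apply: two_level_nonneg_symmetric.
have Ne : Mat_edges R n e N.
  split => // [i|]; last by rewrite SE; apply: sum_two_level_mx.
  by rewrite row_sum_two_level //; case: ifP => _; apply: rpred_nat.
apply: (row_sums_of_small_spectral_radius (l := l) Mns _ _ nE) => //.
- by move=> i; rewrite rpredB ?rpred_nat.
- by rewrite -SE.
rewrite Mmin (le_trans (min_spectral_radius_le n0 Ne)) //.
apply: spectral_radius_ub n0 _ => z; apply: eigenvalue_le_quad_form.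
  by case: Nns.
by move=> u; apply: quad_form_two_level.
Qed.

Lemma row_sum_eq0 (R : realType) n (M : 'M[R]_n) : nonneg_symmetric M ->
  \sum_i \sum_j M i j = 0 -> forall i, row_sum M i = 0.
Proof.
move=> [_ M0] /eqP; rewrite psumr_eq0 => [/allP z i|i _]; last exact: sumr_ge0.
exact/eqP/(z i)/mem_index_enum.
Qed.

Theorem theorem1p5 (R : realType) (n e : nat) (n_gt0 : (0 < n)%N)
    (M : 'M[R]_n) (d1 d2 n1 n2 : nat) :
  Mat_edges R n e M ->
  spectral_radius M = min_spectral_radius (Mat_edges R n e) ->
  d1 = ((2 * e) %/ n)%N -> d2 = d1.+1 ->
  n2 = ((2 * e) %% n)%N -> n1 = (n - n2)%N ->
  Mat_rows R n d1 n1 d2 n2 M.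
Proof.
move=> Me Mmin d1E d2E n2E n1E; have [Mns _ Msum] := Me.
have n2n : (n2 < n)%N by rewrite n2E ltn_mod.
have nE : n = (n1 + n2)%N by lia.
have eE : (2 * e = n1 * d1 + n2 * d2)%N.
  by rewrite {1}(divn_eq (2 * e) n) -d1E -n2E d2E; nia.
have [e0|e0] := posnP e.
  have [d10 n20] : d1 = 0%N /\ n2 = 0%N by rewrite d1E n2E e0 muln0 div0n mod0n.
  split => //; exists [set: 'I_n]%SET; split.
  - by rewrite cardsT card_ord; lia.
  - by rewrite finset.setCT cards0.
  - by move=> i _; rewrite d10 (row_sum_eq0 Mns) // Msum e0.
  - by move=> i; rewrite inE.
(* The zero block of the extremal matrix goes to the group of smaller total. *)
have [le|lt] := leqP (n1 * d1) (n2 * d2).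
- have [||P [cP Pp Pq]] := row_sums_of_minimizer Me Mmin e0 nE _ eE le; [nia|by left|].
  split => //; exists P; split => //.
  by have := cardsC P; rewrite card_ord; lia.
- have [|||||P [cP Pp Pq]] := @row_sums_of_minimizer _ _ _ M n2 n1 d2 d1 Me Mmin e0;
    [lia|lia|lia|lia|by right|].
  split => //; exists (~: P)%SET; split => //.
  + by have := cardsC P; rewrite card_ord; lia.
  + by rewrite finset.setCK.
  + by move=> i; rewrite inE => /Pq.
  + by move=> i; rewrite inE negbK => /Pp.
Qed.
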